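(* There is a map $F$ from the power set $\mathcal{P}(\omega)$ to the collection of those subsets of $\mathbb{R}$ that are reducible to $\mathbb{Q}$ by monotone continuous functions, such that for all $a,b\subseteq\omega$, $$a\subseteq_{\mathsf{fin}} b\iff F(a)\leq F(b).$$ That is, the quasi-order $\mathcal{P}(\omega)/\mathsf{fin}$ is reducible to the Wadge quasi-order for the real line restricted to the sets that are reducible to $\mathbb{Q}$ by monotone functions.
   Context: For subsets $A,B$ of $\mathbb{R}$, $A\leq B$ ($A$ is reducible to $B$) means that there is a continuous function $f\colon\mathbb{R}\to\mathbb{R}$ with $A=f^{-1}(B)$; this is the Wadge quasi-order for the real line. $A$ is reducible to $\mathbb{Q}$ by a monotone function if there is a continuous $f\colon\mathbb{R}\to\mathbb{R}$ with $A=f^{-1}(\mathbb{Q})$ that is (weakly) increasing or (weakly) decreasing. $\mathcal{P}(\omega)/\mathsf{fin}$ is here regarded as the quasi-order on $\mathcal{P}(\omega)$ given by inclusion up to finite error: $a\subseteq_{\mathsf{fin}}b$ iff $a\setminus b$ is finite. A reduction between quasi-orders is a function $F$ such that $x\leq y$ if and only if $F(x)\leq F(y)$ for all $x,y$, and a quasi-order is reducible to another if there is a reduction from the former to the latter. *)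

(* Defs.v *)
From mathcomp Require Import all_boot all_order all_algebra.
From mathcomp Require Import all_classical all_reals all_analysis.
Import Order.TTheory GRing.Theory Num.Theory.
Import numFieldNormedType.Exports.

Set Implicit Arguments.
Unset Strict Implicit.
Unset Printing Implicit Defensive.

Local Open Scope classical_set_scope.
Local Open Scope ring_scope.

Definition subset_fin (a b : set nat) : Prop := finite_set (a `\` b).

Definition wadge_le (R : realType) (A B : set R) : Prop :=
  exists f : R -> R, continuous f /\ A = f @^-1` B.

Definition rationals (R : realType) : set R := range (@ratr R).
Arguments rationals : clear implicits.

Definition monotone_fun (R : realType) (f : R -> R) : Prop :=
  {homo f : x y / x <= y} \/ {homo f : x y / x <= y >-> y <= x}.

Definition monotone_reducible_to_rationals (R : realType) (A : set R) : Prop :=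
  exists f : R -> R,
    [/\ continuous f, monotone_fun f & A = f @^-1` rationals R].

(* Main.v *)
(* For a monotone [h], the set of times [t] with [h t] rational can be made to
   look like a line of unit stretches separated by the points [n + 1/2]:
   open sets of rational times are dense in even stretches and open sets of
   irrational times are dense in odd ones, while each separating point has a
   prescribed colour (rational or not).  A continuous reduction between two such
   lines must send even stretches into even ones, odd into odd, and separating
   points to separating points of the same colour, so it is a walk on stretches.

   The colours are read off a zigzag path of heights which climbs to 1, returns
   to 0, climbs to 2, returns to 0, and so on; then a walk preserves heights.
   [F a] is the preimage of this coloured line under a clock that pauses at the
   step where height [k + 1] is first reached, for every [k] outside [a].  A walk
   crossing a pause needs a pause at a step of the same height, hence of the same
   index; as the walk crosses all but finitely many steps, [F a <= F b] gives
   [a \subset b] up to a finite set.  Conversely the zigzag is symmetric about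
   each of its peaks, so finitely many offending pauses can be removed by folding
   the initial part of the line onto the pause-free descent after a peak. *)
Require Import Defs.
From mathcomp Require Import all_boot all_order all_algebra.
From mathcomp Require Import all_classical all_reals all_analysis.
From mathcomp Require Import ring lra zify.
Import Order.TTheory GRing.Theory Num.Theory.
Import numFieldNormedType.Exports.

Set Implicit Arguments.
Unset Strict Implicit.
Unset Printing Implicit Defensive.

Local Open Scope classical_set_scope.
Local Open Scope ring_scope.

(** * Continuous functions on the line *)

Section Real.
Variable R : realType.
Implicit Types (f g : R -> R) (x y a b : R).

Lemma continuous_epsP f : continuous f <->
  forall x e, 0 < e -> exists2 d, 0 < d & forall y, `|y - x| < d -> `|f y - f x| < e.
Proof.
split=> [cf x e e0|H x].
  have /cvgrPdist_lt/(_ e e0)/nbhs_ballP[d /= d0 H] := cf x.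
  exists d => // y yd; rewrite distrC; apply: H.
  by rewrite /ball/= distrC.
apply/cvgrPdist_lt => e e0; have [d d0 Hd] := H x e e0.
apply/nbhs_ballP; exists d => //= y; rewrite /ball/= => yd.
by rewrite distrC; apply: Hd; rewrite distrC.
Qed.

Lemma continuous_compT f g : continuous f -> continuous g -> continuous (g \o f).
Proof. by move=> cf cg x; apply: continuous_comp; [exact: cf|exact: cg]. Qed.

Lemma continuous_IVT f a b v : continuous f -> a <= b ->
  (f a <= v <= f b) || (f b <= v <= f a) -> exists2 c, a <= c <= b & f c = v.
Proof.
move=> cf ab H; have [c cab fc] : exists2 c, c \in `[a, b] & f c = v.
  apply: IVT => //; first exact: continuous_subspaceT.
  by rewrite ge_min le_max; case/orP: H => /andP[-> ->]; rewrite ?orbT.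
by exists c => //; move: cab; rewrite in_itv.
Qed.

(** * Gluing functions along the unit intervals *)

Lemma truncn_itv1 x : 0 <= x -> (Num.truncn x)%:R <= x < (Num.truncn x)%:R + 1.
Proof. by move=> x0; rewrite natr1 truncn_itv. Qed.

(** [Num.truncn] vanishes on negative reals, so the piece [f_ 0] serves on the whole half-line below
    1 and the pieces have to match at positive integers only. *)
Definition glue (f_ : nat -> R -> R) (x : R) : R := f_ (Num.truncn x) x.

Definition glueable (f_ : nat -> R -> R) : Prop :=
  forall n, f_ n (n%:R + 1) = f_ n.+1 (n%:R + 1).

Lemma glueE_lt (f_ : nat -> R -> R) n x :
  n%:R <= x < n%:R + 1 -> glue f_ x = f_ n x.
Proof. by rewrite /glue natr1 => /truncn_def ->. Qed.

Lemma glue0 (f_ : nat -> R -> R) x : x < 1 -> glue f_ x = f_ 0%N x.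
Proof.
by move=> x1; rewrite /glue; have /truncn0Pn -> : ~~ (1 <= x) by rewrite -ltNge.
Qed.

Lemma glueE (f_ : nat -> R -> R) n x : glueable f_ ->
  n%:R <= x <= n%:R + 1 -> glue f_ x = f_ n x.
Proof.
move=> H /andP[nx]; rewrite le_eqVlt => /orP[/eqP xE|xn].
  by rewrite xE H; apply: glueE_lt; rewrite -natr1; lra.
by apply: glueE_lt; rewrite nx.
Qed.

Lemma glue_continuous (f_ : nat -> R -> R) :
  glueable f_ -> (forall n, continuous (f_ n)) -> continuous (glue f_).
Proof.
move=> H cf; apply/continuous_epsP => x e e0.
have [x1|x1] := ltP x 1.
  have [d d0 Hd] := (continuous_epsP (f_ 0%N)).1 (cf 0%N) x e e0.
  exists (Num.min d (1 - x)); first by rewrite lt_min d0 subr_gt0.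
  move=> y; rewrite lt_min => /andP[yd y1]; rewrite !glue0 //; first exact: Hd.
  by move: y1; rewrite ltr_norml => /andP[]; lra.
have x0 : 0 <= x by lra.
have /andP[] := truncn_itv1 x0.
case: (Num.truncn x) => [|n]; first by lra.
rewrite -natr1 => nx xn.
have [d d0 Hd] := (continuous_epsP (f_ n)).1 (cf n) x e e0.
have [d' d'0 Hd'] := (continuous_epsP (f_ n.+1)).1 (cf n.+1) x e e0.
have [xE|xN] := eqVneq x (n%:R + 1).
  exists (Num.min (Num.min d d') 1); first by rewrite !lt_min d0 d'0 ltr01.
  move=> y; rewrite !lt_min => /andP[/andP[yd yd'] y1].
  move: y1; rewrite ltr_norml => /andP[y1 y2].
  have [yx|yx] := ltP y x.
    by rewrite !(@glueE _ n) //; [exact: Hd|lra|lra].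
  rewrite !(@glueE_lt _ n.+1) -?natr1; [exact: Hd'|lra|lra].
have nx' : n%:R + 1 < x by rewrite lt_neqAle eq_sym xN.
exists (Num.min d' (Num.min (x - (n%:R + 1)) (n%:R + 1 + 1 - x))).
  by rewrite !lt_min d'0 !subr_gt0 nx' xn.
move=> y; rewrite !lt_min => /and3P[yd].
rewrite ltr_norml => /andP[? ?]; rewrite ltr_norml => /andP[? ?].
rewrite !(@glueE_lt _ n.+1) -?natr1; [|lra|lra].
exact: Hd'.
Qed.

Lemma glue_homo (f_ : nat -> R -> R) : glueable f_ ->
  (forall n x y, n%:R <= x -> x <= y -> y <= n%:R + 1 -> f_ n x <= f_ n y) ->
  forall x y, 0 <= x -> x <= y -> glue f_ x <= glue f_ y.
Proof.
move=> H mf.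
have fin k x y : k%:R <= x -> x <= y -> y <= k%:R + 1 -> glue f_ x <= glue f_ y.
  by move=> kx xy yk; rewrite !(@glueE _ k) //; [exact: mf|lra|lra].
(* Cells are crossed one at a time, by induction on their number. *)
have step k m y : m%:R <= y -> y <= (m + k)%:R + 1 -> glue f_ m%:R <= glue f_ y.
  elim: k y => [|k IH] y my; first by rewrite addn0; exact: fin.
  rewrite addnS -natr1 => yk.
  have [yk'|yk'] := leP y ((m + k)%:R + 1); first exact: IH.
  apply: (@le_trans _ _ (glue f_ ((m + k)%:R + 1))).
    by apply: IH => //; rewrite natrD; have := ler0n R k; lra.
  by apply: (fin (m + k).+1); rewrite -?natr1; lra.
move=> x y x0 xy; have /andP[nx xn] := truncn_itv1 x0.
have [yn|yn] := leP y ((Num.truncn x)%:R + 1); first exact: (fin (Num.truncn x)).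
apply: (@le_trans _ _ (glue f_ ((Num.truncn x)%:R + 1))).
  by apply: (fin (Num.truncn x)); lra.
rewrite natr1; apply: (step (Num.truncn y)); first by rewrite -natr1; lra.
have /andP[_ yn'] : (Num.truncn y)%:R <= y < (Num.truncn y)%:R + 1.
  by apply: truncn_itv1; lra.
by rewrite natrD; have := ler0n R (Num.truncn x).+1; lra.
Qed.

Lemma exists_irrational : exists t : R, [/\ 0 < t, t < 1 / 2 & ~ rationals R t].
Proof.
(* The bound [pi / 2 < 2] makes [pi / 8] less than [1 / 2]. *)
exists (pi / 8%:R); split; first by have := pi_gt0 R; lra.
  have /andP[_] := pihalf_02 R; lra.
move=> [q _ qE]; apply: (@pi_irrationnal R); exists (q * 8%:R) => //.
by rewrite rmorphM /= qE ratr_nat divfK // pnatr_eq0.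
Qed.

End Real.

(** * Monotone functions with prescribed plateaus *)

Lemma exists_halfX_lt (R : realType) (e : R) : 0 < e -> exists n, (1 / 2) ^+ n < e.
Proof.
move=> e0; pose n := (Num.truncn e^-1).+1; exists n.
have ei : e^-1 < n%:R by exact: truncnS_gt.
have n2 : e^-1 < 2 ^+ n.
  by rewrite (lt_trans ei) // -natrX ltr_nat ltn_expl.
by rewrite div1r exprVn -[ltRHS]invrK ltf_pV2 ?posrE ?invr_gt0 ?exprn_gt0.
Qed.

Section Staircase.
Variables (R : realType) (D : set R) (f : R -> nat).
Hypothesis f_inj : {in D &, injective f}.
Implicit Types x y d : R.

Local Notation w i := ((1 / 2 : R) ^+ i.+1).

Let hit i y : bool := `[< exists2 d, D d & f d = i /\ d < y >].

Let psum n y : R := \sum_(i < n) w i * (hit i y)%:R.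

(** The sum of [w (f d)] over all points [d < y] of [D], as a supremum of partial sums: it jumps by
    [w (f d)] at each [d] in [D] and is continuous elsewhere. *)
Let jumps y : R := sup (range (psum ^~ y)).

Let w_gt0 i : 0 < w i. Proof. by rewrite exprn_gt0 // divr_gt0. Qed.

Let hit_homo i x y : x <= y -> (hit i x <= hit i y)%N.
Proof.
move=> xy; case: (boolP (hit i x)) => // /asboolP[d Dd [fd dx]].
by rewrite lt0b; apply/asboolP; exists d => //; split => //; exact: lt_le_trans xy.
Qed.

Let psum_homo n x y : x <= y -> psum n x <= psum n y.
Proof.
by move=> xy; apply: ler_sum => i _; rewrite ler_pM2l // ler_nat hit_homo.
Qed.

Let psum_le n k y : psum n y <= psum (n + k) y.
Proof.
elim: k => [|k IH]; first by rewrite addn0.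
by rewrite addnS (le_trans IH) // /psum big_ord_recr /= lerDl mulr_ge0 ?ler0n // ltW.
Qed.

Let psum_tail n k y : psum (n + k) y <= psum n y + (1 / 2) ^+ n - (1 / 2) ^+ (n + k).
Proof.
elim: k => [|k IH]; first by rewrite addn0 addrK.
rewrite addnS [psum _.+1 _]big_ord_recr /= -/(psum (n + k) y).
have : w (n + k) * (hit (n + k) y)%:R <= w (n + k).
  by rewrite ger_pMr // lern1 leq_b1.
by move: IH; rewrite (exprS _ (n + k)); lra.
Qed.

Let psum_ub m n y : psum m y <= psum n y + (1 / 2) ^+ n.
Proof.
have e0 k : 0 < (1 / 2 : R) ^+ k by rewrite exprn_gt0 // divr_gt0.
have [mn|/ltnW nm] := leqP m n.
  by rewrite -(subnKC mn) (le_trans (psum_le m (n - m) y)) // lerDl ltW.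
by rewrite -(subnKC nm) (le_trans (psum_tail n _ y)) // gerBl ltW.
Qed.

Let psum_le1 n y : psum n y <= 1.
Proof. by have := psum_ub n 0 y; rewrite /psum big_ord0 add0r expr0. Qed.

Let psum_le_jumps n y : psum n y <= jumps y.
Proof.
apply: sup_upper_bound; last by exists n.
by split; [exists (psum 0 y), 0%N|exists 1 => _ [k _ <-]; exact: psum_le1].
Qed.

Let jumps_le z y : (forall n, psum n y <= z) -> jumps y <= z.
Proof. by move=> H; apply: ge_sup; [exists (psum 0 y), 0%N|move=> _ [k _ <-]]. Qed.

Let jumps_ge0 y : 0 <= jumps y.
Proof. by have := psum_le_jumps 0 y; rewrite /psum big_ord0. Qed.

Let jumps_le1 y : jumps y <= 1. Proof. exact: jumps_le. Qed.

Let jumps_homo x y : x <= y -> jumps x <= jumps y.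
Proof.
move=> xy; apply: jumps_le => n.
exact: le_trans (psum_homo n xy) (psum_le_jumps _ _).
Qed.

Let jumps_gap d y : D d -> d < y -> jumps d + w (f d) <= jumps y.
Proof.
move=> Dd dy; rewrite -lerBrDr; apply: jumps_le => n; rewrite lerBrDr.
(* As [m] is at least [n] and exceeds [f d], the partial sum up to [m] has the term of [d], which
   vanishes at [d] and counts at [y]. *)
have := psum_le n (f d).+1 d; set m := (n + _)%N => le_nm.
have lt_m : (f d < m)%N by rewrite /m; lia.
apply: le_trans (psum_le_jumps m y); apply: (@le_trans _ _ (psum m d + w (f d))).
  by rewrite lerD2r.
rewrite /psum (bigD1 (Ordinal lt_m)) //= [leRHS](bigD1 (Ordinal lt_m)) //=.
have -> : hit (f d) d = false.
  apply/negP => /asboolP[d' Dd' [/f_inj]]; rewrite !inE => /(_ Dd' Dd) ->.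
  by rewrite ltxx.
have -> : hit (f d) y = true by apply/asboolP; exists d.
rewrite mulr0 add0r mulr1 [leLHS]addrC lerD2l.
by apply: ler_sum => i _; rewrite ler_pM2l // ler_nat hit_homo // ltW.
Qed.

(** Only terms of index at least [n] can change between [x] and [y], and together they amount to at
    most [(1 / 2) ^+ n]. *)
Let jumps_near n x y :
  (forall d, D d -> (f d < n)%N -> ~~ (x <= d < y)) -> jumps y <= jumps x + (1 / 2) ^+ n.
Proof.
move=> H; apply: jumps_le => m; apply: le_trans (psum_ub m n y) _.
rewrite lerD2r; apply: le_trans (psum_le_jumps n x).
apply: ler_sum => i _; rewrite ler_pM2l // ler_nat.
case: (boolP (hit i y)) => // /asboolP[d Dd [fd dy]].
rewrite lt0b; apply/asboolP; exists d => //; split => //.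
by have := H d Dd; rewrite fd ltn_ord dy andbT -ltNge; apply.
Qed.

Let avoid n y : ~ D y ->
  exists2 e, 0 < e & forall d, D d -> (f d < n)%N -> e < `|d - y|.
Proof.
move=> Dy; elim: n => [|n [e e0 IH]]; first by exists 1.
have [[d Dd fd]|nD] := pselect (exists2 d, D d & f d = n); last first.
  exists e => // d Dd; rewrite ltnS leq_eqVlt => /orP[/eqP fd|]; last exact: IH.
  by exfalso; apply: nD; exists d.
have dy : 0 < `|d - y|.
  by rewrite normr_gt0 subr_eq0; apply/eqP => dE; apply: Dy; rewrite -dE.
exists (Num.min e (`|d - y| / 2)); first by rewrite lt_min e0 divr_gt0.
move=> d' Dd'; rewrite ltnS leq_eqVlt gt_min => /orP[/eqP fd'|fd']; last by rewrite IH.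
have -> : d' = d by apply: f_inj; rewrite ?inE // fd'.
by rewrite [X in _ || X](_ : _ = true) ?orbT //; lra.
Qed.

(* A generalized inverse of the strictly increasing map [y + jumps y], whose
   jumps, at the points of [D], become the plateaus. *)
Let stair x : R := sup [set y | y + jumps y <= x].

Let stair_ge x y : y + jumps y <= x -> y <= stair x.
Proof.
move=> H; apply: sup_upper_bound => //; split; first by exists y.
by exists x => z /=; have := jumps_ge0 z; lra.
Qed.

Let stair_le x z : (forall y, y + jumps y <= x -> y <= z) -> stair x <= z.
Proof.
by move=> H; apply: ge_sup => //; exists (x - 1) => /=; have := jumps_le1 (x - 1); lra.
Qed.

Let stair_lt x y : stair x < y -> x < y + jumps y.
Proof. by move=> H; rewrite ltNge; apply/negP => /stair_ge; rewrite leNgt H. Qed.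

Let stair_gt x y : y < stair x -> y + jumps y <= x.
Proof.
move=> H; rewrite leNgt; apply/negP => xy; move: H; rewrite ltNge.
move/negP; apply; apply: stair_le => z zx; rewrite leNgt; apply/negP => yz.
by have := jumps_homo (ltW yz); lra.
Qed.

Let stair_homo : {homo stair : x y / x <= y}.
Proof. by move=> x y xy; apply: stair_le => z zx; apply: stair_ge; lra. Qed.

(** The map [y + jumps y] expands distances, so its inverse is 1-Lipschitz. *)
Let stair_lip x y : x <= y -> stair y <= stair x + (y - x).
Proof.
move=> xy; rewrite leNgt; apply/negP => H.
set z := stair x + (y - x) in H.
have z1 : stair x < (z + stair y) / 2 - (y - x) by rewrite /z in H *; lra.
have := stair_lt z1.
have /stair_gt : (z + stair y) / 2 < stair y by lra.
have : jumps ((z + stair y) / 2 - (y - x)) <= jumps ((z + stair y) / 2).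
  by apply: jumps_homo; lra.
lra.
Qed.

Let stairK y : stair (y + jumps y) = y.
Proof.
apply/eqP; rewrite eq_le stair_ge // andbT; apply: stair_le => z.
by case: (leP z y) => // /[dup] /ltW/jumps_homo; lra.
Qed.

Let stair_flat d : D d -> stair (d + jumps d + w (f d)) = d.
Proof.
move=> Dd; apply/eqP; rewrite eq_le; apply/andP; split; last first.
  by apply: stair_ge; have := w_gt0 (f d); lra.
by apply: stair_le => z; case: (leP z d) => // dz; have := jumps_gap Dd dz; lra.
Qed.

(** A plateau over a value means that [jumps] has a jump there, which happens at points of [D]
    only. *)
Let flat_mem x x' : x < x' -> stair x = stair x' -> D (stair x).
Proof.
move=> xx' E; apply: contrapT => /avoid avd.
(* The terms beyond [n] give less than half of the plateau's length and the window of radius [e'] at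
   most a quarter, yet [y + jumps y] must grow by more than the whole length across the window. *)
have [n nE] : exists n, (1 / 2) ^+ n < (x' - x) / 2 by apply: exists_halfX_lt; lra.
have [e e0 He] := avd n; set y := stair x in E He.
pose e' := Num.min e ((x' - x) / 8).
have e'0 : 0 < e' by rewrite lt_min e0; lra.
have /andP[e'e e'x] : (e' <= e) && (e' <= (x' - x) / 8) by rewrite -le_min.
have /stair_gt H1 : y - e' < stair x by rewrite -/y; lra.
have /stair_lt H2 : stair x' < y + e' by rewrite -E; lra.
suff : jumps (y + e') <= jumps (y - e') + (1 / 2) ^+ n by lra.
apply: jumps_near => d Dd fd; apply/negP => dy.
by have := He d Dd fd; rewrite ltNge ler_norml => /negP; apply; lra.
Qed.

Let stair_continuous : continuous stair.
Proof.
apply/continuous_epsP => x e e0; exists e => // y.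
have := @stair_lip x y; have := @stair_lip y x.
have := @stair_homo x y; have := @stair_homo y x.
by rewrite !ltr_norml; case: (leP x y) => xy;
  [move=> _ /(_ isT) ? _ /(_ isT) ?|move=> /(_ (ltW xy)) ? _ /(_ (ltW xy)) ? _]; lra.
Qed.

Lemma staircase_of_inj : exists s : R -> R,
  [/\ continuous s, {homo s : x y / x <= y}, forall y, exists x, s x = y &
      forall y, D y <-> exists x x', [/\ x < x', s x = y & s x' = y]].
Proof.
exists stair; split=> // [y|y]; first by exists (y + jumps y).
split=> [Dy|[x [x' [xx' <- /esym/(flat_mem xx')]]]//].
exists (y + jumps y), (y + jumps y + w (f y)); split; last 2 first.
- exact: stairK.
- exact: stair_flat.
by rewrite ltrDl.
Qed.

End Staircase.

(** Over each value in [D] the function is constant on an interval, which gives that interval a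
    single colour; a countable dense [D] thus yields sets of rational and of irrational times with
    interior. *)
Lemma staircase (R : realType) (D : set R) : countable D -> exists s : R -> R,
  [/\ continuous s, {homo s : x y / x <= y}, forall y, exists x, s x = y &
      forall y, D y <-> exists x x', [/\ x < x', s x = y & s x' = y]].
Proof. by move=> /countable_injP[f /staircase_of_inj]. Qed.

(** * The coloured line of heights *)

Section Rationals.
Variable R : realType.
Implicit Types x y t : R.
Local Notation rats := (rationals R).

Lemma rationalsD x y : rats x -> rats y -> rats (x + y).
Proof. by move=> [p _ <-] [q _ <-]; exists (p + q) => //; rewrite rmorphD. Qed.

Lemma rationalsN x : rats x -> rats (- x).
Proof. by move=> [p _ <-]; exists (- p) => //; rewrite rmorphN. Qed.

Lemma rationals_nat n : rats n%:R.
Proof. by exists n%:R => //; rewrite ratr_nat. Qed.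

Lemma rationals_half : rats (1 / 2).
Proof. by exists (1 / 2) => //; rewrite fmorph_div /= rmorph1 ratr_nat. Qed.

Lemma rationals_addl x y : rats x -> rats (x + y) <-> rats y.
Proof.
move=> rx; split=> [rxy|]; last exact: rationalsD.
by have := rationalsD (rationalsN rx) rxy; rewrite addKr.
Qed.

Lemma rationals_normB x y : rats y -> rats `|x - y| <-> rats x.
Proof.
move=> ry; have ->: rats x <-> rats (x - y).
  by rewrite addrC rationals_addl //; exact: rationalsN.
case: ger0P => // _; split; last exact: rationalsN.
by move/rationalsN; rewrite opprK.
Qed.

Lemma shifted_rational_between t x y : x < y ->
  exists q : rat, x < ratr q + t < y.
Proof.
move=> xy; have /rat_in_itvoo[q] : x - t < y - t by lra.
by rewrite in_itv /= => qxy; exists q; lra.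
Qed.

Lemma colours_between (g : R -> R) x y : continuous g -> x < y -> g x < g y ->
  (exists t, x < t < y /\ rats (g t)) /\ (exists t, x < t < y /\ ~ rats (g t)).
Proof.
move=> cg xy gxy; have [th [_ _ irr]] := exists_irrational R.
(* Every coset of the rationals is dense: the shift [s = 0] gives rational values and [s = th]
   irrational ones. *)
have hits s : exists t q, x < t < y /\ g t = ratr q + s.
  have [q /andP[xq qy]] := shifted_rational_between s gxy.
  have [|t /andP[xt ty] gt] := @continuous_IVT R g x y (ratr q + s) cg (ltW xy).
    by apply/orP; left; lra.
  exists t, q; split=> //.
  have tx : t != x by apply/eqP => tx; move: gt xq; rewrite tx; lra.
  have yt : y != t by apply/eqP => yt; move: gt qy; rewrite yt; lra.
  by rewrite !lt_neqAle eq_sym tx xt eq_sym yt.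
split.
  by have [t [q [xty gt]]] := hits 0; exists t; split=> //; exists q => //; rewrite gt addr0.
have [t [q [xty gt]]] := hits th; exists t; split=> //; rewrite gt.
by rewrite rationals_addl //; exists q.
Qed.

End Rationals.

(** * Colouring the stretches between separating values *)

Section Colouring.
Variables (R : realType) (th : R).
Hypotheses (th0 : 0 < th) (th_lt : th < 1 / 2) (th_irr : ~ rationals R th).
Local Notation rats := (rationals R).

(** The separating values, rational for even [i] and irrational for odd [i]; as [th < 1 / 2], they
    interlace with the half-integers. *)
Let sep i : R := i%:R + (odd i)%:R * th.

Let odd_th i : 0 <= (odd i)%:R * th < 1 / 2.
Proof.
by move: th0 th_lt; case: (odd i); rewrite ?mulr1n ?mulr0n ?mul1r ?mul0r; lra.
Qed.

Let sep_lt i : sep i < i%:R + 1 / 2 < sep i.+1.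
Proof.
rewrite /sep -(natr1 i); move: (odd_th i) (odd_th i.+1).
by move: (_ * th) (_ * th) => a b; lra.
Qed.

Let sep_homo i j : (i <= j)%N -> sep i <= sep j.
Proof.
move=> /subnK <-; elim: (j - i)%N => [|k IH] //; rewrite addSn (le_trans IH) //.
by have := sep_lt (k + i); lra.
Qed.

Let sep_rat i : rats (sep i) <-> ~~ odd i.
Proof.
rewrite /sep rationals_addl; last exact: rationals_nat.
case: (odd i); rewrite ?mulr1n ?mulr0n ?mul1r ?mul0r; split=> // _.
exact: (rationals_nat R 0).
Qed.

(** The values that receive plateaus: dense sets of rationals in the even stretches and of
    irrationals in the odd ones. The strict bounds keep the separating values out. *)
Let D : set R :=
  [set y | exists i, [/\ sep i < y, y < sep i.+1 & rats (y - (odd i)%:R * th)]].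

Let D_countable : countable D.
Proof.
apply: (@sub_countable _ _ _ (range (fun p : rat * bool => ratr p.1 + p.2%:R * th))).
  apply: subset_card_le => y [i [_ _ [q _ qE]]].
  by exists (q, odd i) => //=; rewrite qE subrK.
by apply: (card_le_trans (card_image_le _ _)); exact: countableP.
Qed.

Let D_rat i y : sep i < y -> y < sep i.+1 ->
  rats (y - (odd i)%:R * th) -> rats y <-> ~~ odd i.
Proof.
move=> _ _ ry; rewrite -{1}(subrK ((odd i)%:R * th) y) rationals_addl //.
case: (odd i); rewrite ?mulr1n ?mulr0n ?mul1r ?mul0r; split=> // _.
exact: (rationals_nat R 0).
Qed.

Let D_stretch i y : D y -> sep i <= y -> y <= sep i.+1 ->
  sep i < y /\ (rats y <-> ~~ odd i).
Proof.
move=> [j [jy yj ry]] iy yi; have -> : i = j; last by split=> //; exact: D_rat.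
apply/eqP; rewrite eqn_leq; apply/andP; split; rewrite leqNgt; apply/negP.
  by move=> /sep_homo; lra.
by move=> /sep_homo; lra.
Qed.

Let sep_notD i : ~ D (sep i).
Proof.
move=> Ds; case: i Ds => [|i] Ds.
  have [] := @D_stretch 0 _ Ds; rewrite ?lexx //.
    by rewrite sep_homo.
  by rewrite ltxx.
have := @D_stretch i.+1 _ Ds; rewrite lexx ltxx sep_homo //.
by case.
Qed.

(** The value that the line is to take at time [m / 2]: [i + 1 / 2] at time [i], and [sep i.+1] at
    time [i + 1 / 2]. *)
Let level m : R := if odd m then sep m./2.+1 else (m./2)%:R + 1 / 2.

Let level_lt m : level m < level m.+1.
Proof.
rewrite /level /= uphalf_half; case: (odd m) => /=.
  by have := sep_lt m./2.+1; rewrite add1n -(natr1 m./2); lra.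
by rewrite add0n; have := sep_lt m./2; lra.
Qed.

(** The line is a staircase over [D] after a piecewise linear change of time, strictly increasing on
    nonnegative times, that puts [level m] at time [m / 2]. Plateaus colour the stretches; since
    separating values are not in [D], the line is not constant on any interval ending at a
    separating point. *)
Lemma coloured_line_of_irrational : exists k : R -> R,
  [/\ continuous k,
      forall (x y : R), 0 <= x -> x <= y -> k x <= k y,
      forall i, k i%:R = i%:R + 1 / 2 &
  [/\ forall i (x y : R), 0 <= x -> i%:R - 1 / 2 <= x -> x < y -> y <= i%:R + 1 / 2 ->
        exists u v, [/\ x <= u, u < v, v <= y &
          forall t, u <= t <= v -> rats (k t) <-> ~~ odd i],
      forall i (x y : R), 0 <= x -> x < y -> x = i%:R + 1 / 2 \/ y = i%:R + 1 / 2 ->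
        (exists t, x < t < y /\ rats (k t)) /\ (exists t, x < t < y /\ ~ rats (k t)) &
      forall i, rats (k (i%:R + 1 / 2)) <-> odd i]].
Proof.
have [s [cs hs ss sD]] := staircase D_countable.
have [v vE] := choice (fun m => ss (level m)).
have v_lt m : v m < v m.+1.
  by rewrite ltNge; apply/negP => /hs; rewrite !vE leNgt level_lt.
pose f m (y : R) := v m + (y - m%:R) * (v m.+1 - v m).
have fg : glueable f by move=> n; rewrite /f -(natr1 n); ring.
have f_lt m (x y : R) : x < y -> f m x < f m y.
  by move=> xy; rewrite /f ltrD2l ltr_pM2r ?subr_gt0 // ltrD2r.
have cf m : continuous (f m).
  move=> x; apply: cvgD; first exact: cvg_cst.
  by apply: cvgMl; apply: cvgB; [exact: cvg_id|exact: cvg_cst].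
have fhomo n (x y : R) : n%:R <= x -> x <= y -> y <= n%:R + 1 -> f n x <= f n y.
  by move=> _; rewrite le_eqVlt => /orP[/eqP->|/f_lt/ltW].
pose r x := glue f (2 * x).
have cr : continuous r.
  apply: (@continuous_compT R ( *%R 2) (glue f)); last exact: glue_continuous.
  exact: mulrl_continuous.
have r_homo (x y : R) : 0 <= x -> x <= y -> r x <= r y.
  by move=> x0 xy; apply: glue_homo => //; lra.
have r_lt (x y : R) : 0 <= x -> x < y -> r x < r y.
  move=> x0 xy; have /andP[nx xn] : (Num.truncn (2 * x))%:R <= 2 * x
      < (Num.truncn (2 * x))%:R + 1 by apply: truncn_itv1; lra.
  set n := Num.truncn _ in nx xn.
  (* Strictness is gained inside the linear cell of [2 * x]; beyond it weak monotonicity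
     suffices. *)
  pose z := Num.min y ((n%:R + 1) / 2).
  have xz : x < z by rewrite lt_min xy; lra.
  have /andP[zy zn] : (z <= y) && (z <= (n%:R + 1) / 2) by rewrite -le_min.
  apply: (@lt_le_trans _ _ (r z)); last by apply: r_homo => //; lra.
  rewrite /r !(@glueE _ _ n) //; [by apply: f_lt; lra|lra|lra].
have r_int i : r i%:R = v i.*2.
  rewrite /r -natrM mul2n (@glueE _ _ i.*2) //; last by lra.
  by rewrite /f subrr mul0r addr0.
have r_half i : r (i%:R + 1 / 2) = v i.*2.+1.
  have -> : r (i%:R + 1 / 2) = glue f (i.*2.+1)%:R.
    by rewrite /r -(natr1 i.*2) -mul2n natrM; congr glue; lra.
  rewrite (@glueE _ _ i.*2.+1) //; last by lra.
  by rewrite /f subrr mul0r addr0.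
pose k := s \o r.
have k_homo (x y : R) : 0 <= x -> x <= y -> k x <= k y by move=> x0 xy; apply/hs/r_homo.
have k_half i : k (i%:R + 1 / 2) = sep i.+1.
  by rewrite /k /= r_half vE /level /= odd_double /= uphalf_double.
have ck : continuous k by exact: continuous_compT.
have k_int i : k i%:R = i%:R + 1 / 2.
  by rewrite /k /= r_int vE /level odd_double doubleK.
have k_const (x y : R) : 0 <= x -> x < y -> k x = k y -> D (k x).
  by move=> x0 xy kxy; apply/sD; exists (r x), (r y); split=> //; exact: r_lt.
exists k; split=> //; split=> [i x y x0 ix xy yi|i x y x0 xy xyi|i]; last first.
- by rewrite k_half; rewrite sep_rat /= negbK.
- apply: colours_between => //; rewrite lt_neqAle k_homo ?(ltW xy) // andbT.
  apply/eqP => kxy; have Dk := k_const _ _ x0 xy kxy.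
  by case: xyi => E; move: Dk; [rewrite E|rewrite kxy E]; rewrite k_half; exact: sep_notD.
have kx : sep i <= k x.
  (* Stretch 0 is cut off at time 0, where the line has the value [1 / 2], above [sep 0 = 0]. *)
  case: i ix yi => [|i] ix yi.
    have := k_homo 0 x (lexx _) x0; rewrite (k_int 0%N).
    by rewrite /sep mul0r; lra.
  rewrite -k_half; apply: k_homo; last by move: ix; rewrite -(natr1 i); lra.
  by rewrite addr_ge0 // ler0n.
have ky : k y <= sep i.+1 by rewrite -k_half; apply: k_homo => //; lra.
have kxy : k x <= k y by apply: k_homo => //; lra.
(* Either the line is constant on the interval, with a value in [D], or it runs through the plateau
   over some value of [D] strictly between [k x] and [k y]. *)
move: (kxy); rewrite le_eqVlt => /orP[/eqP kE|k_lt].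
  exists x, y; split=> // t /andP[xt ty].
  have -> : k t = k x.
    by apply/eqP; rewrite eq_le [X in _ && X]k_homo // kE k_homo //; lra.
  by have [] := @D_stretch i _ (k_const _ _ x0 xy kE) => //; rewrite kE.
have [q /andP[xq qy]] := shifted_rational_between ((odd i)%:R * th) k_lt.
set d := ratr q + _ in xq qy.
have Dd : D d by exists i; split; [lra|lra|rewrite addrK; exists q].
have [a [b [ab sa sb]]] := (sD d).1 Dd.
have xa : r x < a by rewrite ltNge; apply/negP => /hs; rewrite sa leNgt xq.
have yb : b < r y by rewrite ltNge; apply/negP => /hs; rewrite sb leNgt qy.
have [|u /andP[xu uy] ru] := @continuous_IVT R r x y a cr (ltW xy).
  by apply/orP; left; lra.
have [|w /andP[xw wy] rw] := @continuous_IVT R r x y b cr (ltW xy).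
  by apply/orP; left; lra.
exists u, w; split=> //.
  by rewrite ltNge; apply/negP => wu; have := r_homo w u (le_trans x0 xw) wu; lra.
move=> t /andP[ut tw].
have -> : k t = d.
  apply/eqP; rewrite eq_le -{1}sb -rw -sa -ru.
  by rewrite (k_homo t w) ?(k_homo u t) //; lra.
by have [] := @D_stretch i d Dd => //; lra.
Qed.

End Colouring.

Lemma coloured_line (R : realType) : exists k : R -> R,
  [/\ continuous k,
      forall (x y : R), 0 <= x -> x <= y -> k x <= k y,
      forall i, k i%:R = i%:R + 1 / 2 &
  [/\ forall i (x y : R), 0 <= x -> i%:R - 1 / 2 <= x -> x < y -> y <= i%:R + 1 / 2 ->
        exists u v, [/\ x <= u, u < v, v <= y &
          forall t, u <= t <= v -> rationals R (k t) <-> ~~ odd i],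
      forall i (x y : R), 0 <= x -> x < y -> x = i%:R + 1 / 2 \/ y = i%:R + 1 / 2 ->
        (exists t, x < t < y /\ rationals R (k t)) /\
        (exists t, x < t < y /\ ~ rationals R (k t)) &
      forall i, rationals R (k (i%:R + 1 / 2)) <-> odd i]].
Proof. by have [th []] := exists_irrational R; exact: coloured_line_of_irrational. Qed.

(** * The zigzag *)

Section Zigzag.
Local Open Scope nat_scope.

(** The recursion adds a return to height 0, at time [(peak N').*2], and a fresh climb of [N'.+1]
    steps. *)
Fixpoint peak N : nat := if N is N'.+1 then ((peak N').*2 + N').+1 else 0.

(** The step from height [k] that ends at [peak k.+1], hence the first to reach height [k.+1]; its
    height recovers [k]. *)
Definition rise k : nat := (peak k).*2 + k.

(** Structural recursion on a bound: the value is the intended one for [n <= peak N], where it does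
    not depend on [N] ([heightE]). *)
Fixpoint height_upto N n : nat :=
  if N is N'.+1 then
    if (n <= peak N') then height_upto N' n
    else if (n <= (peak N').*2) then height_upto N' ((peak N').*2 - n)
    else (n - (peak N').*2)
  else 0.

(* Zigzag path: from [0] it climbs to [N], reached for the first time at
   [peak N], then retraces its whole history down to [0] at time [2 * peak N],
   and climbs to [N + 1] along the steps up to [rise N]. *)
Definition height n : nat := height_upto n n.

Lemma leq_peak N : (N <= peak N).
Proof. by elim: N => //= N IH; lia. Qed.

Lemma peak_homo M N : (M <= N) -> (peak M <= peak N).
Proof.
by move=> /subnK <-; elim: (N - M) => //= k IH; apply: leq_trans IH _; lia.
Qed.

Lemma rise_lt_peak k N : (k < N) -> (rise k < peak N).
(* [(rise k).+1] computes to [peak k.+1]. *)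
Proof. exact: peak_homo. Qed.

Lemma leq_rise k N : (N <= k) -> ((peak N).*2 <= rise k).
Proof. by move=> /peak_homo; rewrite /rise; lia. Qed.

Lemma heightE N n : (n <= peak N) -> height n = height_upto N n.
Proof.
have up M k : (n <= peak M) -> height_upto (k + M) n = height_upto M n.
  move=> nM; elim: k => // k IH; rewrite addSn /= (leq_trans nM) //.
  by apply: peak_homo; lia.
move=> nN; rewrite /height; case: (leqP n N) => [le|/ltnW le].
  by rewrite -(subnK le) (up n) ?leq_peak.
by rewrite -{1}(subnK le) (up N).
Qed.

Lemma height_mirror N i : (i <= (peak N).*2) -> height ((peak N).*2 - i) = height i.
Proof.
(* The first half is mirrored by definition; the second half follows by applying this to the
   mirrored time. *)
have low j : (j <= peak N) -> height ((peak N).*2 - j) = height j.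
  move=> jN; have [->|ltN] : (j = peak N \/ j < peak N) by lia.
    by congr height; lia.
  rewrite (@heightE N.+1) /=; last by lia.
  rewrite leqNgt ifF; last by lia.
  rewrite ifT; last by lia.
  by rewrite subKn ?(@heightE N j) //; lia.
move=> iN; have [/low //|lti] := leqP i (peak N).
by rewrite -(low ((peak N).*2 - i)) ?subKn //; lia.
Qed.

Lemma height_climb N j : (j <= N.+1) -> height ((peak N).*2 + j) = j.
Proof.
case: j => [|j] jN; first by rewrite addn0 -{1}[_.*2]subn0 height_mirror.
rewrite (@heightE N.+1) /=; last by lia.
by rewrite !ifF; lia.
Qed.

Lemma height_bottom N : height (peak N).*2 = 0%N.
Proof. by rewrite -[_.*2]addn0 height_climb. Qed.

Lemma height_rise k : height (rise k) = k.
Proof. by rewrite height_climb. Qed.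

(** On a retraced part the steps are mirrored earlier ones, with ascents and descents exchanged; the
    new climb is explicit. *)
Lemma height_step n : height n.+1 = (height n).+1 \/ height n = (height n.+1).+1.
Proof.
have [N] : exists N, (n < peak N) by exists n.+1; exact: leq_peak.
elim: N n => [|N IH] n; first by [].
move=> /= nN; have [/IH //|Nn] := ltnP n (peak N).
have [n2|n2] := ltnP n (peak N).*2.
  rewrite -(height_mirror (ltnW n2)) -(height_mirror n2).
  have -> : ((peak N).*2 - n = ((peak N).*2 - n.+1).+1) by lia.
  by have [||] := IH ((peak N).*2 - n.+1); [lia|right|left].
rewrite -(subnKC n2) -addnS !height_climb; first by left.
  by lia.
by lia.
Qed.

Lemma odd_height n : odd (height n) = odd n.
Proof. by elim: n => //= n <-; case: (height_step n) => -> /=; rewrite ?negbK. Qed.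

End Zigzag.

(** * The coloured line of times *)

Section Timeline.
Variables (R : realType) (k : R -> R).
Local Notation rats := (rationals R).
Implicit Types x y t u v : R.
Hypothesis k_continuous : continuous k.
Hypothesis k_homo : forall (x y : R), 0 <= x -> x <= y -> k x <= k y.
Hypothesis k_nat : forall i, k i%:R = i%:R + 1 / 2.
Hypothesis k_plateaus : forall i x y,
  0 <= x -> i%:R - 1 / 2 <= x -> x < y -> y <= i%:R + 1 / 2 ->
  exists u v, [/\ x <= u, u < v, v <= y &
    forall t, u <= t <= v -> rats (k t) <-> ~~ odd i].
Hypothesis k_colours : forall i x y,
  0 <= x -> x < y -> x = i%:R + 1 / 2 \/ y = i%:R + 1 / 2 ->
  (exists t, x < t < y /\ rats (k t)) /\ (exists t, x < t < y /\ ~ rats (k t)).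
Hypothesis k_half : forall i, rats (k (i%:R + 1 / 2)) <-> odd i.

Let slope n : R := (height n.+1)%:R - (height n)%:R.

Let path_on n t : R := (height n)%:R + (t - n%:R) * slope n.

Let path : R -> R := glue path_on.

Let path_glueable : glueable path_on.
Proof. by move=> n; rewrite /path_on /slope -(natr1 n); ring. Qed.

Let pathE n t : n%:R <= t <= n%:R + 1 -> path t = path_on n t.
Proof. exact: glueE. Qed.

Let path_onP n :
  (height n.+1 = (height n).+1 /\
    forall t, path_on n t = t + ((height n)%:R - n%:R)) \/
  (height n = (height n.+1).+1 /\
    forall t, path_on n t = ((height n)%:R + n%:R) - t).
Proof.
by rewrite /path_on /slope; case: (height_step n) => E; [left|right]; split=> // t;
  rewrite E -natr1; ring.
Qed.

Let pathP n :
  (height n.+1 = (height n).+1 /\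
    forall t, n%:R <= t <= n%:R + 1 -> path t = t + ((height n)%:R - n%:R)) \/
  (height n = (height n.+1).+1 /\
    forall t, n%:R <= t <= n%:R + 1 -> path t = ((height n)%:R + n%:R) - t).
Proof.
by case: (path_onP n) => [] [hn H]; [left|right]; split=> // t nt; rewrite (pathE nt).
Qed.

Let X : set R := [set t | rats (k (path t))].

Let plateaus_incr i c x y : (forall t, x <= t <= y -> path t = t + c) ->
  0 <= x + c -> i%:R - 1 / 2 <= x + c -> x < y -> y + c <= i%:R + 1 / 2 ->
  exists u v, [/\ x <= u, u < v, v <= y & forall t, u <= t <= v -> X t <-> ~~ odd i].
Proof.
move=> pE x0 ix xy yi.
have [|u [v [xu uv vy H]]] := k_plateaus x0 ix _ yi; first by rewrite ltrD2r.
exists (u - c), (v - c); split; [lra|lra|lra|].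
by move=> t ?; rewrite /X /= pE; [apply: H|]; lra.
Qed.

Let plateaus_decr i c x y : (forall t, x <= t <= y -> path t = c - t) ->
  0 <= c - y -> i%:R - 1 / 2 <= c - y -> x < y -> c - x <= i%:R + 1 / 2 ->
  exists u v, [/\ x <= u, u < v, v <= y & forall t, u <= t <= v -> X t <-> ~~ odd i].
Proof.
move=> pE x0 ix xy yi.
have [|u [v [xu uv vy H]]] := k_plateaus x0 ix _ yi; first by lra.
exists (c - v), (c - u); split; [lra|lra|lra|].
by move=> t ?; rewrite /X /= pE; [apply: H|]; lra.
Qed.

Let X_plateaus n x y : 0 <= x -> n%:R - 1 / 2 <= x -> x < y -> y <= n%:R + 1 / 2 ->
  exists u v, [/\ x <= u, u < v, v <= y & forall t, u <= t <= v -> X t <-> ~~ odd n].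
Proof.
move=> x0 nx xy yn; rewrite -(odd_height n).
have h0 m : 0 <= (height m)%:R :> R by exact: ler0n.
(* The path turns at integers only, so it is enough to find the plateau on one side of [n], where
   the path is affine. *)
have [xn|xn] := ltP x n%:R.
  case: n nx yn xn => [|n] nx yn xn; first by lra.
  move: nx yn xn; rewrite -(natr1 n) => nx yn xn.
  pose z := Num.min y (n%:R + 1).
  have xz : x < z by rewrite lt_min xy; lra.
  have /andP[zy zn] : (z <= y) && (z <= n%:R + 1) by rewrite -le_min.
  suff [u [v [xu uv vz H]]] : exists u v, [/\ x <= u, u < v, v <= z &
      forall t, u <= t <= v -> X t <-> ~~ odd (height n.+1)].
    by exists u, v; split=> //; lra.
  have := h0 n; have := h0 n.+1; have := ler0n R n.
  case: (pathP n) => [] [hn pE] ? ? ?.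
    apply: (@plateaus_incr _ ((height n)%:R - n%:R)) => //; rewrite ?hn -?(natr1 (height n));
      [by move=> t ?; apply: pE; lra|lra|lra|lra].
  apply: (@plateaus_decr _ ((height n)%:R + n%:R)) => //; rewrite ?hn -?(natr1 (height n.+1));
    [by move=> t ?; rewrite pE ?hn -?(natr1 (height n.+1)); lra|lra|lra|lra].
pose z := Num.min y (n%:R + 1 / 2).
have := h0 n; have := h0 n.+1; have := ler0n R n.
case: (pathP n) => [] [hn pE] ? ? ?.
  apply: (@plateaus_incr _ ((height n)%:R - n%:R)) => //;
    [by move=> t ?; apply: pE; lra|lra|lra|lra].
have h1 : 1 <= (height n)%:R :> R by rewrite hn -natr1; lra.
apply: (@plateaus_decr _ ((height n)%:R + n%:R)) => //;
  [by move=> t ?; apply: pE; lra|lra|lra|lra].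
Qed.

Let X_colours n x y : 0 <= x -> x < y -> x = n%:R + 1 / 2 \/ y = n%:R + 1 / 2 ->
  (exists t, x < t < y /\ X t) /\ (exists t, x < t < y /\ ~ X t).
Proof.
have h0 m : 0 <= (height m)%:R :> R by exact: ler0n.
(* Cut the interval down to the cell of [n], on which the path is affine and sends [n + 1 / 2] to a
   half-integer. *)
move=> x0 xy xyn; pose a := Num.max x n%:R; pose b := Num.min y (n%:R + 1).
have /andP[ax an] : (x <= a) && (n%:R <= a) by rewrite -ge_max.
have /andP[yb nb] : (b <= y) && (b <= n%:R + 1) by rewrite -le_min.
have ab : a < b by rewrite lt_min !gt_max xy; case: xyn; lra.
have abn : a = n%:R + 1 / 2 \/ b = n%:R + 1 / 2.
  case: xyn => E; [left|right]; rewrite /a /b E; [apply/max_idPl|apply/min_idPl]; lra.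
suff [[s [sab Xs]] [t [tab Xt]]] :
    (exists t, a < t < b /\ X t) /\ (exists t, a < t < b /\ ~ X t).
  by split; [exists s|exists t]; split=> //; lra.
have := h0 n; have := h0 n.+1.
case: (pathP n) => [] [hn pE] h1 h2.
  have [|||[s [sab Xs]] [t [tab Xt]]] := @k_colours (height n)
    (a + ((height n)%:R - n%:R)) (b + ((height n)%:R - n%:R)); [lra|lra| |].
    by case: abn; [left|right]; lra.
  split; [exists (s - ((height n)%:R - n%:R))|exists (t - ((height n)%:R - n%:R))];
    (split; [lra|]); rewrite /X /= pE ?subrK //; lra.
have {}h2 : (height n)%:R = (height n.+1)%:R + 1 :> R by rewrite hn natr1.
have [|||[s [sab Xs]] [t [tab Xt]]] := @k_colours (height n.+1)
    ((height n)%:R + n%:R - b) ((height n)%:R + n%:R - a); [lra|lra| |].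
  by case: abn; [right|left]; lra.
split; [exists ((height n)%:R + n%:R - s)|exists ((height n)%:R + n%:R - t)];
  (split; [lra|]); rewrite /X /= pE ?subKr //; lra.
Qed.

(** At [n + 1 / 2] the path is halfway between two consecutive heights, that is, at the smaller one
    plus [1 / 2]. *)
Let X_half n : X (n%:R + 1 / 2) <-> odd (minn (height n) (height n.+1)).
Proof.
have nn : n%:R <= (n%:R + 1 / 2 : R) <= n%:R + 1 by move: (n%:R : R) => z; lra.
rewrite /X /=; case: (pathP n) => [] [hn pE]; rewrite (pE _ nn) -k_half hn.
  rewrite (minn_idPl (leqnSn _)).
  by have -> : n%:R + 1 / 2 + ((height n)%:R - n%:R) = (height n)%:R + 1 / 2 :> R by lra.
rewrite (minn_idPr (leqnSn _)) -(natr1 (height n.+1)).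
by have -> : (height n.+1)%:R + 1 + n%:R - (n%:R + 1 / 2) = (height n.+1)%:R + 1 / 2 :> R by lra.
Qed.

Let X_mirror N t : 0 <= t <= (peak N).*2%:R -> X ((peak N).*2%:R - t) <-> X t.
Proof.
move=> /andP[t0 tN]; rewrite /X /=.
suff -> : path ((peak N).*2%:R - t) = path t by [].
(* The endpoint is treated apart, since truncation would place it in the next cell. *)
have [->|tN'] := eqVneq t (peak N).*2%:R.
  have at_nat n : path n%:R = (height n)%:R.
    by rewrite (@pathE n) ?lexx ?lerDl ?ler01 // /path_on subrr mul0r addr0.
  by rewrite subrr (at_nat 0%N) at_nat height_bottom.
have {tN' tN} tN : t < (peak N).*2%:R by rewrite lt_neqAle tN'.
have /andP[nt tn] := truncn_itv1 t0; set n := Num.truncn t in nt tn.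
have nN : (n < (peak N).*2)%N by rewrite -(ltr_nat R); lra.
have E : ((peak N).*2 - n.+1)%:R = (peak N).*2%:R - (n%:R + 1) :> R.
  by rewrite natrB // natr1.
rewrite (@pathE n t) ?(@pathE ((peak N).*2 - n.+1)%N) ?E; [|lra|lra].
rewrite /path_on /slope E height_mirror //.
have -> : ((peak N).*2 - n.+1).+1 = ((peak N).*2 - n)%N by lia.
by rewrite height_mirror ?(ltnW nN) //; ring.
Qed.

(** The total variation of [k \o path] up to time [t]: each completed step contributes 1, by
    [k_nat]. Reflections and shifts by rationals preserve rationality, so descents are unfolded into
    a monotone function with the same rational times. *)
Let reduction_on n t : R := n%:R + `|k (path_on n t) - ((height n)%:R + 1 / 2)|.

Let reduction_glueable : glueable reduction_on.
Proof.
move=> n; rewrite /reduction_on {1}path_glueable /path_on -(natr1 n) subrr mul0r addr0.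
rewrite k_nat subrr normr0 addr0; congr (_ + _).
case: (height_step n) => ->; rewrite -(natr1 (height _)).
  by rewrite ger0_norm; lra.
by rewrite ler0_norm; lra.
Qed.

Let X_reduction : exists h : R -> R, [/\ continuous h,
  forall (x y : R), 0 <= x -> x <= y -> h x <= h y &
  forall t, 0 <= t -> X t <-> rats (h t)].
Proof.
exists (glue reduction_on); split.
- apply: glue_continuous => // n; rewrite /reduction_on.
  have cp : continuous (path_on n).
    move=> x; apply: cvgD; first exact: cvg_cst.
    by apply: cvgMl; apply: cvgB; [exact: cvg_id|exact: cvg_cst].
  move=> x; apply: cvgD; first exact: cvg_cst.
  apply: cvg_norm; apply: cvgB; last exact: cvg_cst.
  exact: (continuous_compT cp k_continuous).
- apply: glue_homo => // n x y nx xy yn; rewrite /reduction_on lerD2l.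
  have := ler0n R (height n); have := ler0n R (height n.+1); rewrite -k_nat.
  case: (path_onP n) => [] [hn pE]; rewrite !pE hn -(natr1 (height _)) => ? ?.
    by rewrite !ger0_norm ?lerD2r ?subr_ge0; try apply: k_homo; lra.
  by rewrite !ler0_norm ?lerN2 ?lerD2r ?subr_le0; try apply: k_homo; lra.
- move=> t t0; have nt := truncn_itv1 t0.
  rewrite (@glueE_lt _ _ _ _ nt) /X /= (@pathE (Num.truncn t)); last first.
    by case/andP: nt => -> /ltW ->.
  rewrite rationals_addl ?rationals_normB //; last exact: rationals_nat.
  by apply: rationalsD; [exact: rationals_nat|exact: rationals_half].
Qed.

Lemma coloured_timeline_of_line : exists X : set R,
  [/\ forall n (x y : R), 0 <= x -> n%:R - 1 / 2 <= x -> x < y -> y <= n%:R + 1 / 2 ->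
        exists u v, [/\ x <= u, u < v, v <= y &
          forall t, u <= t <= v -> X t <-> ~~ odd n],
      forall n (x y : R), 0 <= x -> x < y -> x = n%:R + 1 / 2 \/ y = n%:R + 1 / 2 ->
        (exists t, x < t < y /\ X t) /\ (exists t, x < t < y /\ ~ X t),
      forall n, X (n%:R + 1 / 2) <-> odd (minn (height n) (height n.+1)),
      forall N t, 0 <= t <= (peak N).*2%:R -> X ((peak N).*2%:R - t) <-> X t &
      exists h : R -> R, [/\ continuous h,
        forall (x y : R), 0 <= x -> x <= y -> h x <= h y &
        forall t, 0 <= t -> X t <-> rats (h t)]].
Proof. by exists X; split. Qed.

End Timeline.

Lemma coloured_timeline (R : realType) : exists X : set R,
  [/\ forall n (x y : R),
        0 <= x -> n%:R - 1 / 2 <= x -> x < y -> y <= n%:R + 1 / 2 ->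
        exists u v, [/\ x <= u, u < v, v <= y &
          forall t, u <= t <= v -> X t <-> ~~ odd n],
      forall n (x y : R), 0 <= x -> x < y -> x = n%:R + 1 / 2 \/ y = n%:R + 1 / 2 ->
        (exists t, x < t < y /\ X t) /\ (exists t, x < t < y /\ ~ X t),
      forall n, X (n%:R + 1 / 2) <-> odd (minn (height n) (height n.+1)),
      forall N t, 0 <= t <= (peak N).*2%:R -> X ((peak N).*2%:R - t) <-> X t &
      exists h : R -> R, [/\ continuous h,
        forall (x y : R), 0 <= x -> x <= y -> h x <= h y &
        forall t, 0 <= t -> X t <-> rationals R (h t)]].
Proof.
by have [k [? ? ? [? ? ?]]] := coloured_line R; exact: (@coloured_timeline_of_line _ k).
Qed.

(** * Pausing clocks *)

Lemma continuous_maxT (R : realType) (f g : R -> R) :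
  continuous f -> continuous g -> continuous (fun x => Num.max (f x) (g x)).
Proof. by move=> cf cg x; exact: (continuous_max (cf x) (cg x)). Qed.

Lemma continuous_minT (R : realType) (f g : R -> R) :
  continuous f -> continuous g -> continuous (fun x => Num.min (f x) (g x)).
Proof. by move=> cf cg x; exact: (continuous_min (cf x) (cg x)). Qed.

Section Clock.
Variable R : realType.
Implicit Types (x y s : R) (fl : nat -> bool).

Let pause s : R := Num.max (Num.min (2 * s) (1 / 2)) (2 * s - 1).

Let pause0 : pause 0 = 0.
Proof. by rewrite /pause mulr0 min_l ?max_l; lra. Qed.

Let pause1 : pause 1 = 1.
Proof. by rewrite /pause mulr1 min_r ?max_r; lra. Qed.

Let pauseP s : [\/ s < 1 / 4 /\ pause s = 2 * s,
  1 / 4 <= s <= 3 / 4 /\ pause s = 1 / 2 | 3 / 4 < s /\ pause s = 2 * s - 1].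
Proof.
rewrite /pause; have [s1|s1] := ltP s (1 / 4).
  by constructor 1; split=> //; rewrite min_l ?max_l //; lra.
have [s3|s3] := leP s (3 / 4).
  by constructor 2; split; [lra|rewrite min_r ?max_l //; lra].
by constructor 3; split=> //; rewrite min_r ?max_r //; lra.
Qed.

Let clock_on fl n x : R := if fl n then n%:R + pause (x - n%:R) else x.

Let clock_on_nat fl n : clock_on fl n n%:R = n%:R.
Proof. by rewrite /clock_on subrr pause0 addr0 if_same. Qed.

Let clock_on_natS fl n : clock_on fl n (n%:R + 1) = n%:R + 1.
Proof. by rewrite /clock_on addrAC subrr add0r pause1 if_same. Qed.

Let clock_on_glueable fl : glueable (clock_on fl).
Proof. by move=> n; rewrite clock_on_natS natr1 clock_on_nat. Qed.

(* The identity of [0, +oo[, except that the clock stops at time [n + 1/2]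
   while [x] runs through [n + 1/4, n + 3/4], for every [n] in [fl]. *)
Definition clock fl x : R := Num.max 0 (glue (clock_on fl) x).

(** The clock shows [n + 1 / 2] exactly from [stop_start fl n] to [stop_end fl n], a single point if
    [n] is not in [fl]. *)
Definition stop_start fl n : R := n%:R + if fl n then 1 / 4 else 1 / 2.

Definition stop_end fl n : R := n%:R + if fl n then 3 / 4 else 1 / 2.

Let clock_on_homo fl n x y : x <= y -> clock_on fl n x <= clock_on fl n y.
Proof.
move=> xy; rewrite /clock_on; case: (fl n) => //.
by case: (pauseP (x - n%:R)) => [] [? ->]; case: (pauseP (y - n%:R)) => [] [? ->]; lra.
Qed.

Let glue_clock_homo fl x y : 0 <= x -> x <= y ->
  glue (clock_on fl) x <= glue (clock_on fl) y.
Proof. by apply: glue_homo => // n u v _ uv _; exact: clock_on_homo. Qed.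

Lemma clock_le0 fl x : x <= 0 -> clock fl x = 0.
Proof.
move=> x0; rewrite /clock glue0; last by lra.
by rewrite max_l // -[leRHS](clock_on_nat fl 0); exact: clock_on_homo.
Qed.

Let clockE fl n x : n%:R <= x <= n%:R + 1 -> clock fl x = clock_on fl n x.
Proof.
move=> nx; rewrite /clock (glueE _ nx) // max_r //.
apply: le_trans (ler0n R n) _; rewrite -[leLHS](clock_on_nat fl n).
by apply: clock_on_homo; case/andP: nx.
Qed.

Lemma clock_nat fl n : clock fl n%:R = n%:R.
Proof. by rewrite (@clockE _ n) ?clock_on_nat // lexx lerDl ler01. Qed.

Let clock_natS fl n : clock fl (n%:R + 1) = n%:R + 1.
Proof. by rewrite natr1 clock_nat. Qed.

Lemma clock_ge0 fl x : 0 <= clock fl x.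
Proof. by rewrite le_max lexx. Qed.

Lemma clock_continuous fl : continuous (clock fl).
Proof.
have cp : continuous pause.
  have c2 : continuous (fun s : R => 2 * s) by exact: mulrl_continuous.
  apply: continuous_maxT.
    by apply: continuous_minT => // s; exact: cvg_cst.
  by move=> s; apply: cvgB; [exact: c2|exact: cvg_cst].
have cn n : continuous (clock_on fl n).
  rewrite /clock_on; case: (fl n) => x; last exact: cvg_id.
  apply: cvgD; first exact: cvg_cst.
  have cs : continuous (fun y : R => y - n%:R).
    by move=> y; apply: cvgB; [exact: cvg_id|exact: cvg_cst].
  exact: (continuous_compT cs cp).
by apply: continuous_maxT; [move=> x; exact: cvg_cst|exact: glue_continuous].
Qed.

Lemma clock_homo fl : {homo clock fl : x y / x <= y}.
Proof.
move=> x y xy; have [x0|x0] := leP x 0; first by rewrite clock_le0 ?clock_ge0.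
by rewrite ge_max le_max lexx /= le_max glue_clock_homo ?orbT // ltW.
Qed.

Lemma clock_id fl n x : ~~ fl n -> n%:R <= x <= n%:R + 1 -> clock fl x = x.
Proof. by move=> /negPf fn nx; rewrite (clockE _ nx) /clock_on fn. Qed.

Lemma eq_clock fl fl' n x : fl n -> fl' n -> n%:R <= x <= n%:R + 1 ->
  clock fl x = clock fl' x.
Proof. by move=> f f' nx; rewrite !(clockE _ nx) /clock_on f f'. Qed.

Lemma clock_itv fl n x : n%:R <= x <= n%:R + 1 -> n%:R <= clock fl x <= n%:R + 1.
Proof.
move=> nx; rewrite (clockE _ nx) -{1}(clock_on_nat fl n) -{1}(clock_on_natS fl n).
by case/andP: nx => nx xn; rewrite !clock_on_homo.
Qed.

Lemma stop_start_itv fl n : n%:R < stop_start fl n <= n%:R + 1 / 2.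
Proof. by rewrite /stop_start; case: (fl n); lra. Qed.

Lemma stop_end_itv fl n : n%:R + 1 / 2 <= stop_end fl n < n%:R + 1.
Proof. by rewrite /stop_end; case: (fl n); lra. Qed.

Lemma clock_lt fl n x : (clock fl x < n%:R + 1 / 2) = (x < stop_start fl n).
Proof.
have [xn|nx] := ltP x n%:R.
  have := clock_homo fl (ltW xn); have := stop_start_itv fl n.
  by rewrite clock_nat => ? ?; apply/idP/idP => _; lra.
have [xn|xn] := leP x (n%:R + 1); last first.
  have := clock_homo fl (ltW xn); have := stop_start_itv fl n.
  by rewrite clock_natS => ? ?; apply/idP/idP => ?; lra.
rewrite (@clockE fl n) ?nx // /clock_on /stop_start; case: (fl n) => //.
by case: (pauseP (x - n%:R)) => [] [? ->]; apply/idP/idP => ?; lra.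
Qed.

Lemma clock_gt fl n x : (n%:R + 1 / 2 < clock fl x) = (stop_end fl n < x).
Proof.
have [xn|nx] := ltP x n%:R.
  have := clock_homo fl (ltW xn); have := stop_end_itv fl n.
  by rewrite clock_nat => ? ?; apply/idP/idP => ?; lra.
have [xn|xn] := leP x (n%:R + 1); last first.
  have := clock_homo fl (ltW xn); have := stop_end_itv fl n.
  by rewrite clock_natS => ? ?; apply/idP/idP => ?; lra.
rewrite (@clockE fl n) ?nx // /clock_on /stop_end; case: (fl n) => //.
by case: (pauseP (x - n%:R)) => [] [? ->]; apply/idP/idP => ?; lra.
Qed.

(** Within the cell of [x], only a pause can make the clock stand still. *)
Lemma clock_inj fl x y : 0 <= x -> x < y -> clock fl x = clock fl y ->
  exists n, clock fl x = n%:R + 1 / 2.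
Proof.
move=> x0 xy E; have /andP[nx xn] := truncn_itv1 x0.
set n := Num.truncn x in nx xn; exists n.
pose z := Num.min y (n%:R + 1).
have xz : x < z by rewrite lt_min xy.
have /andP[zy zn] : (z <= y) && (z <= n%:R + 1) by rewrite -le_min.
have {E} : clock fl x = clock fl z.
  by apply/eqP; rewrite eq_le clock_homo ?(ltW xz) //= E clock_homo.
rewrite !(@clockE fl n) ?nx ?zn ?(ltW xn) ?(le_trans nx (ltW xz)) // /clock_on.
case: (fl n) => [|E]; last by lra.
by case: (pauseP (x - n%:R)) => [] [? ->]; case: (pauseP (z - n%:R)) => [] [? ->]; lra.
Qed.

End Clock.

(** * Reductions are walks *)

Section Walk.
Variables (R : realType) (X : set R) (fa fb : nat -> bool) (g : R -> R).
Implicit Types x y t u v : R.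
Hypothesis X_plateaus : forall n x y,
  0 <= x -> n%:R - 1 / 2 <= x -> x < y -> y <= n%:R + 1 / 2 ->
  exists u v, [/\ x <= u, u < v, v <= y & forall t, u <= t <= v -> X t <-> ~~ odd n].
Hypothesis X_colours : forall n x y,
  0 <= x -> x < y -> x = n%:R + 1 / 2 \/ y = n%:R + 1 / 2 ->
  (exists t, x < t < y /\ X t) /\ (exists t, x < t < y /\ ~ X t).
Hypothesis X_half : forall n,
  X (n%:R + 1 / 2) <-> odd (minn (height n) (height n.+1)).
Hypothesis g_continuous : continuous g.
Hypothesis g_reduces : forall x, X (clock fa x) <-> X (clock fb (g x)).

Local Notation H := (@clock R fa).
Local Notation K := (@clock R fb).
Let G x := K (g x).

Let H_continuous : continuous H. Proof. exact: clock_continuous. Qed.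

Let G_continuous : continuous G.
Proof. exact: (continuous_compT g_continuous (@clock_continuous R fb)). Qed.

(** Stretch [n] is the interval between stop [n - 1], or the origin, and stop [n]. *)
Let stretch_start n : R := if n is n'.+1 then stop_end R fa n' else 0.
Local Notation stretch_end := (stop_start R fa).

Let stretch_ltn n : stretch_start n < stretch_end n.
Proof.
case: n => [|n] /=; have := stop_start_itv R fa; first by move/(_ 0%N); lra.
by move=> /(_ n.+1); have := stop_end_itv R fa n; rewrite -(natr1 n); lra.
Qed.

Let stretch_ge0 n : 0 <= stretch_start n.
Proof. by case: n => //= n; have := stop_end_itv R fa n; have := ler0n R n; lra. Qed.

Let H_stop n x : stop_start R fa n <= x <= stop_end R fa n -> H x = n%:R + 1 / 2.
Proof.
move=> /andP[sx xe]; apply/eqP; rewrite eq_le leNgt clock_gt -leNgt xe /=.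
by rewrite leNgt clock_lt -leNgt.
Qed.

Let stop_start_le_end n : stop_start R fa n <= stop_end R fa n.
Proof. by have := stop_start_itv R fa n; have := stop_end_itv R fa n; lra. Qed.

Let H_start n : H (stretch_start n) = Num.max 0 (n%:R - 1 / 2).
Proof.
case: n => [|n] /=; first by rewrite (@clock_nat R fa 0) max_l //; lra.
rewrite (@H_stop n) ?lexx ?stop_start_le_end // -(natr1 n).
by rewrite max_r; have := ler0n R n; lra.
Qed.

Let H_end n : H (stretch_end n) = n%:R + 1 / 2.
Proof. by apply: H_stop; rewrite lexx stop_start_le_end. Qed.

Let H_stretch n x : stretch_start n <= x <= stretch_end n ->
  n%:R - 1 / 2 <= H x <= n%:R + 1 / 2.
Proof.
move=> /andP[/(clock_homo fa) sx /(clock_homo fa)]; rewrite H_end => ->.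
by rewrite andbT (le_trans _ sx) // H_start le_max lexx orbT.
Qed.

(** A repeated value would be some [j + 1 / 2] with [j = n] or [j.+1 = n], but these two stops meet
    the stretch in an endpoint only. *)
Let H_lt n x y : stretch_start n <= x -> x < y -> y <= stretch_end n -> H x < H y.
Proof.
move=> sx xy ye; rewrite lt_neqAle clock_homo ?(ltW xy) // andbT; apply/eqP => E.
have [j Ej] := clock_inj (le_trans (stretch_ge0 n) sx) xy E.
have := clock_lt fa j x; have := clock_gt fa j y.
rewrite -E Ej ltxx => /esym/negbT; rewrite -leNgt => yj /esym/negbT; rewrite -leNgt => jx.
have xe : x <= stretch_end n by lra.
have := H_stretch (n := n) (x := x); rewrite sx xe Ej => /(_ isT) /andP[nj jn].
have [jE|jE] : j = n \/ j.+1 = n.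
  have : (j <= n)%N by rewrite -(ler_nat R); lra.
  have : (n <= j.+1)%N by rewrite -(ler_nat R) -(natr1 j); lra.
  by clear; lia.
- by rewrite jE in jx; lra.
- by rewrite -jE /= in sx; lra.
Qed.

Let small_interval x y a b : a < b -> G x <= a -> b <= G y ->
  exists c d, [/\ Num.min x y <= c, c < d, d <= Num.max x y &
    forall z, c <= z <= d -> a <= G z <= b].
Proof.
move=> ab xa yb; set l := Num.min x y; set r := Num.max x y.
have lr : l <= r by rewrite /l /r; case: (leP x y) => ?; lra.
have [w /andP[lw wr] Gw] : exists2 w, l <= w <= r & G w = (a + b) / 2.
  apply: (continuous_IVT G_continuous lr).
  by rewrite /l /r; case: (leP x y) => _; apply/orP; [left|right]; lra.
have [|e e0 He] := (continuous_epsP G).1 G_continuous w ((b - a) / 2); first by lra.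
have ltlr : l < r.
  rewrite lt_neqAle lr andbT /l /r; apply/eqP; case: (leP x y) => _ xy;
  by move: xa yb; rewrite xy; lra.
pose c := Num.max l (w - e / 2); pose d := Num.min r (w + e / 2).
have /andP[lc wc] : (l <= c) && (w - e / 2 <= c) by rewrite -ge_max.
have /andP[rd wd] : (d <= r) && (d <= w + e / 2) by rewrite -le_min.
exists c, d; split=> //; first by rewrite lt_min !gt_max ltlr; lra.
move=> z zcd; have : `|z - w| < e by rewrite ltr_norml; lra.
by move=> /He; rewrite Gw ltr_norml; lra.
Qed.

(** Crossing from [a] to [b] in a stretch of the other parity, [G] stays on a small interval inside
    a plateau of the other colour, while [H] maps that interval onto one containing a plateau of the
    colour of stretch [n]. *)
Let no_opposite n x y j a b : odd j = ~~ odd n ->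
  stretch_start n <= x <= stretch_end n -> stretch_start n <= y <= stretch_end n ->
  0 <= a -> j%:R - 1 / 2 <= a -> a < b -> b <= j%:R + 1 / 2 ->
  G x <= a -> b <= G y -> False.
Proof.
move=> jn /andP[sx xe] /andP[sy ye] a0 ja ab bj xa yb.
have [u [v [au uv vb Xj]]] := X_plateaus a0 ja ab bj.
have [||c [d [lc cd dr Gcd]]] := @small_interval x y u v uv; [lra|lra|].
have sc : stretch_start n <= c by apply: le_trans lc; rewrite le_min sx.
have de : d <= stretch_end n by apply: le_trans dr _; rewrite ge_max xe.
have Hcd := H_lt sc cd de.
have /andP[Hc _] : n%:R - 1 / 2 <= H c <= n%:R + 1 / 2 by apply: H_stretch; lra.
have /andP[_ Hd] : n%:R - 1 / 2 <= H d <= n%:R + 1 / 2 by apply: H_stretch; lra.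
have [u' [v' [cu uv' vd Xn]]] := X_plateaus (clock_ge0 fa c) Hc Hcd Hd.
have [|z zcd Hz] := @continuous_IVT R H c d u' H_continuous (ltW cd).
  by apply/orP; left; lra.
have : X (H z) <-> ~~ odd n by rewrite Hz; apply: Xn; lra.
have : X (G z) <-> ~~ odd j by apply: Xj; apply: Gcd.
rewrite g_reduces -/(G z) jn negbK => -[j1 j2] [n1 n2].
move: j1 j2 n1 n2; case: (odd n) => j1 j2 n1 n2.
  exact: notF (n1 (j2 isT)).
exact: notF (j1 (n2 isT)).
Qed.

Let stretch_image n : exists m, odd m = odd n /\
  forall x, stretch_start n <= x <= stretch_end n -> m%:R - 1 / 2 <= G x <= m%:R + 1 / 2.
Proof.
(* Both colours occur in the stretch, so [G] is not constant on it. *)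
have [x [y [xn yn Gxy]]] : exists x y, [/\ stretch_start n <= x <= stretch_end n,
    stretch_start n <= y <= stretch_end n & G x < G y].
  have pre t : H (stretch_start n) < t < n%:R + 1 / 2 ->
      exists2 x, stretch_start n <= x <= stretch_end n & H x = t.
    move=> ?; apply: (continuous_IVT H_continuous (ltW (stretch_ltn n))).
    by rewrite H_end; apply/orP; left; lra.
  have [|[t [tn Xt]] [t' [tn' Xt']]] := @X_colours n (H (stretch_start n)) (n%:R + 1 / 2)
    (clock_ge0 _ _) _ (or_intror erefl).
    by rewrite -H_end; apply: (@H_lt n).
  have [x xn Hx] := pre t tn; have [x' xn' Hx'] := pre t' tn'.
  have : G x != G x'.
    apply/eqP => E; apply: Xt'; rewrite -Hx' g_reduces -/(G x') -E /G -g_reduces Hx //.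
  by rewrite neq_lt => /orP[?|?]; [exists x, x'|exists x', x].
have Gx0 : 0 <= G x by exact: clock_ge0.
(* Rounding [G x] selects the stretch [m] with [m - 1 / 2 <= G x < m + 1 / 2]; the way from [G x] up
   to [G y] then fixes its parity. *)
have /andP[] : (Num.truncn (G x + 1 / 2))%:R <= G x + 1 / 2
    < (Num.truncn (G x + 1 / 2))%:R + 1 by apply: truncn_itv1; lra.
set m := Num.truncn _ => mx xm.
have mn : odd m = odd n.
  apply/eqP/negPn/negP => mn.
  have {}mn : odd m = ~~ odd n by move: mn; case: (odd m); case: (odd n).
  have := @no_opposite n x y m (G x) (Num.min (G y) (m%:R + 1 / 2)) mn xn yn Gx0.
  by rewrite lt_min Gxy !ge_min !lexx orbT; apply=> //; lra.
(* Leaving stretch [m] would cross part of a neighbouring stretch, of opposite parity; for [m = 0]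
   the lower exit is excluded because [G] is nonnegative. *)
exists m; split=> // z zn; apply/andP; split; rewrite leNgt; apply/negP => Gz.
  case: m mx xm mn Gz => [|m] mx xm mn Gz;
    first by have := clock_ge0 fb (g z); rewrite -/(G z); lra.
  have mn' : odd m = ~~ odd n by rewrite -mn /= negbK.
  move: mx xm Gz; rewrite -(natr1 m) => mx xm Gz.
  pose a := Num.max (G z) (m%:R - 1 / 2).
  have /andP[za ma] : (G z <= a) && (m%:R - 1 / 2 <= a) by rewrite -ge_max.
  have am : a < m%:R + 1 / 2 by rewrite gt_max; lra.
  apply: (@no_opposite n z x m a (m%:R + 1 / 2)) => //; last by lra.
  by apply: le_trans za; exact: clock_ge0.
have mn' : odd m.+1 = ~~ odd n by rewrite -mn.
pose b := Num.min (G z) (m%:R + 3 / 2).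
have /andP[bz bm] : (b <= G z) && (b <= m%:R + 3 / 2) by rewrite -le_min.
have mb : m%:R + 1 / 2 < b by rewrite lt_min; lra.
by apply: (@no_opposite n x z m.+1 (m%:R + 1 / 2) b) => //;
  rewrite -?(natr1 m); have := ler0n R m; lra.
Qed.

(** During a stop [H] is constant, so [G] keeps one colour; having reached [k + 1 / 2] it cannot
    leave, as both colours occur arbitrarily close on either side. *)
Let stop_const n k x : let c := stop_start R fa n in let d := stop_end R fa n in
  (G c <= k%:R + 1 / 2 <= G d) || (G d <= k%:R + 1 / 2 <= G c) -> c <= x <= d ->
  G x = k%:R + 1 / 2.
Proof.
move=> c d; set s := k%:R + 1 / 2 => scd xcd.
have cd : c <= d by lra.
have [w wcd Gw] := continuous_IVT G_continuous cd scd.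
have const z z' : c <= z <= d -> c <= z' <= d -> X (G z) <-> X (G z').
  by move=> zcd zcd'; rewrite -!g_reduces !(@H_stop n).
have hit z t : c <= z <= d -> (G z < t < s) || (s < t < G z) ->
    exists2 z', c <= z' <= d & G z' = t.
  move=> zcd tz; have [wz|zw] := leP w z.
    have [|z' z'w Gz'] := @continuous_IVT R G w z t G_continuous wz.
      by rewrite Gw; apply/orP; case/orP: tz; [right|left]; lra.
    by exists z' => //; lra.
  have [|z' z'w Gz'] := @continuous_IVT R G z w t G_continuous (ltW zw).
    by rewrite Gw; apply/orP; case/orP: tz; [left|right]; lra.
  by exists z' => //; lra.
have s0 : 0 <= s by rewrite /s; have := ler0n R k; lra.
have [xs|sx|//] := ltgtP (G x) s.
  have [[t [ts Xt]] [t' [ts' Xt']]] := X_colours (clock_ge0 fb (g x)) xs (or_intror erefl).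
  have [|z zcd Gz] := hit x t xcd; first by rewrite ts.
  have [|z' zcd' Gz'] := hit x t' xcd; first by rewrite ts'.
  by exfalso; apply: Xt'; rewrite -Gz' (const _ z) // Gz.
have [[t [ts Xt]] [t' [ts' Xt']]] := X_colours s0 sx (or_introl erefl).
have [|z zcd Gz] := hit x t xcd; first by rewrite ts orbT.
have [|z' zcd' Gz'] := hit x t' xcd; first by rewrite ts' orbT.
by exfalso; apply: Xt'; rewrite -Gz' (const _ z) // Gz.
Qed.

Let walk_step m : (forall n, odd (m n) = odd n /\ forall x,
    stretch_start n <= x <= stretch_end n -> (m n)%:R - 1 / 2 <= G x <= (m n)%:R + 1 / 2) ->
  forall n,
  (m n.+1 = (m n).+1 /\ G (stretch_end n) = (m n)%:R + 1 / 2) \/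
  (m n = (m n.+1).+1 /\ G (stretch_end n) = (m n.+1)%:R + 1 / 2).
Proof.
move=> mE n; have [mn imn] := mE n; have [mn1 imn1] := mE n.+1.
have /andP[c1 c2] : (m n)%:R - 1 / 2 <= G (stretch_end n) <= (m n)%:R + 1 / 2.
  by apply: imn; rewrite lexx ltW.
have /andP[d1 d2] : (m n.+1)%:R - 1 / 2 <= G (stop_end R fa n) <= (m n.+1)%:R + 1 / 2.
  by apply: imn1; rewrite /= lexx /= ltW //; exact: (stretch_ltn n.+1).
have se := stop_start_le_end n.
have neq : m n != m n.+1 by apply/eqP => E; move: mn1; rewrite -E mn /=; case: odd.
(* The stop takes [G] across the boundary of stretch [m n] facing stretch [m n.+1], so [G] stays on
   that boundary; as it ends the stop in stretch [m n.+1], the two stretches are adjacent. *)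
have [lt|gt] : (m n < m n.+1)%N \/ (m n.+1 < m n)%N by move: neq; clear; lia.
  have lt' : (m n)%:R + 1 <= (m n.+1)%:R :> R by rewrite natr1 ler_nat.
  have H1 := @stop_const n (m n).
  have Gs : G (stretch_end n) = (m n)%:R + 1 / 2.
    by apply: H1; [apply/orP; left; lra|rewrite lexx].
  have Ge : G (stop_end R fa n) = (m n)%:R + 1 / 2.
    by apply: H1; [apply/orP; left; lra|rewrite lexx andbT].
  left; split=> //; apply/eqP; rewrite eqn_leq lt andbT -(ler_nat R) -(natr1 (m n)); lra.
have gt' : (m n.+1)%:R + 1 <= (m n)%:R :> R by rewrite natr1 ler_nat.
have H1 := @stop_const n (m n.+1).
have Gs : G (stretch_end n) = (m n.+1)%:R + 1 / 2.
  by apply: H1; [apply/orP; right; lra|rewrite lexx].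
right; split=> //; apply/eqP; rewrite eqn_leq gt andbT -(ler_nat R) -(natr1 (m n.+1)); lra.
Qed.

Let other_colour n x y : 0 <= x -> x < y -> x = n%:R + 1 / 2 \/ y = n%:R + 1 / 2 ->
  exists2 t, x < t < y & ~ (X t <-> X (n%:R + 1 / 2)).
Proof.
move=> x0 xy /(X_colours x0 xy)[[t [txy Xt]] [t' [txy' Xt']]].
have [Xn|Xn] := pselect (X (n%:R + 1 / 2)); last by exists t => // -[/(_ Xt)].
by exists t' => // -[_ /(_ Xn)].
Qed.

(* If [x] spent no time at [n + 1/2], then just before and just after that
   instant both colours occur under [g], which therefore jumps over the stop. *)
Let walk_stop n k : G (stretch_end n) = k%:R + 1 / 2 ->
  (forall x, stretch_start n <= x <= stretch_end n -> G x <= k%:R + 1 / 2) ->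
  (forall x, stretch_start n.+1 <= x <= stretch_end n.+1 -> k%:R + 1 / 2 <= G x) ->
  fb k -> fa n.
Proof.
move=> Gc left right fbk; apply/negPn/negP => /negPf fan.
set c := stretch_end n in Gc left; have ec : stop_end R fa n = c.
  by rewrite /c /stop_end /stop_start fan.
have Hc : H c = n%:R + 1 / 2 by exact: H_end.
have near_c e : 0 < e -> exists2 d, 0 < d & forall x, `|x - c| < d -> `|g x - g c| < e.
  by move=> e0; have [d] := (continuous_epsP g).1 g_continuous c e e0; exists d.
have nstop x : ~ (X (H x) <-> X (n%:R + 1 / 2)) -> G x <> k%:R + 1 / 2.
  move=> nX E; apply: nX; rewrite -Hc !g_reduces.
  by rewrite -/(G x) -/(G c) E Gc.
have gl : g c <= stop_start R fb k.
  rewrite leNgt; apply/negP => gt; have [|d d0 Hd] := near_c (g c - stop_start R fb k).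
    by lra.
  pose x0 := Num.max (stretch_start n) (c - d / 2).
  have /andP[sx0 dx0] : (stretch_start n <= x0) && (c - d / 2 <= x0) by rewrite -ge_max.
  have x0c : x0 < c by rewrite gt_max stretch_ltn; lra.
  have Hx0 : H x0 < n%:R + 1 / 2 by rewrite -Hc; apply: (@H_lt n).
  have [t txn Xt] := other_colour (clock_ge0 fa x0) Hx0 (or_intror erefl).
  have [|x /andP[x0x xc] Hx] := @continuous_IVT R H x0 c t H_continuous (ltW x0c).
    by rewrite Hc; apply/orP; left; lra.
  have Gx : G x < k%:R + 1 / 2.
    rewrite lt_neqAle left ?(le_trans sx0 x0x) ?xc // andbT; apply/eqP.
    by apply: nstop; rewrite Hx.
  move: Gx; rewrite clock_lt => gx.
  have : `|g x - g c| < g c - stop_start R fb k by apply: Hd; rewrite ltr_norml; lra.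
  by rewrite ltr_norml; lra.
have gr : stop_end R fb k <= g c.
  rewrite leNgt; apply/negP => gt; have [|d d0 Hd] := near_c (stop_end R fb k - g c).
    by lra.
  pose x0 := Num.min (stretch_end n.+1) (c + d / 2).
  have /andP[sx0 dx0] : (x0 <= stretch_end n.+1) && (x0 <= c + d / 2) by rewrite -le_min.
  have cs : c < stretch_end n.+1 by rewrite -ec; exact: (stretch_ltn n.+1).
  have x0c : c < x0 by rewrite lt_min cs; lra.
  have Hx0 : n%:R + 1 / 2 < H x0.
    by rewrite -Hc; apply: (@H_lt n.+1) => //=; rewrite ec.
  have n0 : 0 <= n%:R + 1 / 2 :> R by have := ler0n R n; lra.
  have [t txn Xt] := other_colour n0 Hx0 (or_introl erefl).
  have [|x /andP[cx xx0] Hx] := @continuous_IVT R H c x0 t H_continuous (ltW x0c).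
    by rewrite Hc; apply/orP; left; lra.
  have Gx : k%:R + 1 / 2 < G x.
    rewrite lt_neqAle right /= ?ec ?cx ?(le_trans xx0) // andbT; apply/eqP => E.
    by apply: (nstop x); rewrite ?Hx.
  move: Gx; rewrite clock_gt => gx.
  have : `|g x - g c| < stop_end R fb k - g c by apply: Hd; rewrite ltr_norml; lra.
  by rewrite ltr_norml; lra.
by move: gl gr; rewrite /stop_start /stop_end fbk; lra.
Qed.

Lemma reduction_walk : exists m : nat -> nat,
  [/\ forall n, odd (m n) = odd n,
      forall n, m n.+1 = (m n).+1 \/ m n = (m n.+1).+1,
      forall n, odd (minn (height n) (height n.+1)) =
                odd (minn (height (m n)) (height (m n.+1))) &
      forall n, m n.+1 = (m n).+1 -> fb (m n) -> fa n].
Proof.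
have [m mE] := choice stretch_image; have step := walk_step mE.
exists m; split=> n.
- by have [] := mE n.
- by have [[]|[]] := step n; [left|right].
- have colour k : G (stretch_end n) = k%:R + 1 / 2 ->
      odd (minn (height n) (height n.+1)) = odd (minn (height k) (height k.+1)).
    move=> Gn; have := g_reduces (stretch_end n); rewrite H_end -/(G _) Gn !X_half.
    by case: odd; case: odd => // -[H1 H2]; [have := H1 isT|have := H2 isT].
  by have [[E /colour ->]|[E /colour ->]] := step n; rewrite E // minnC.
- move=> mn; apply: (@walk_stop n (m n)).
  + have [[//]|[E]] := step n; move: E; rewrite mn => E; exfalso; move: E; clear; lia.
  + by move=> x /(mE n).2/andP[].
  + by move=> x /(mE n.+1).2/andP[]; rewrite mn -(natr1 (m n)); lra.
Qed.

End Walk.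

(** * Walks preserve heights *)

Section WalkHeights.
Variables (fa fb : nat -> bool) (m : nat -> nat).
Hypothesis m_odd : forall n, odd (m n) = odd n.
Hypothesis m_step : forall n, m n.+1 = (m n).+1 \/ m n = (m n.+1).+1.
Hypothesis m_colour : forall n, odd (minn (height n) (height n.+1)) =
                                odd (minn (height (m n)) (height (m n.+1))).
Hypothesis m_stop : forall n, m n.+1 = (m n).+1 -> fb (m n) -> fa n.

(** The heights at [n] and [m n] have the same parity, so the parity of the lower end of a step
    tells whether it ascends; equal colours make both paths rise and fall together. *)
Let height_m n : height (m n) = (height n + height (m 0))%N.
Proof.
elim: n => // n IH.
have h1 := height_step n.
have h2 : height (m n.+1) = (height (m n)).+1 \/ height (m n) = (height (m n.+1)).+1.
  case: (m_step n) => ->; first exact: height_step.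
  by case: (height_step (m n.+1)); [right|left].
have := m_colour n; have := odd_height n; have := odd_height (m n); rewrite m_odd.
by move: h1 h2 IH; clear; lia.
Qed.

Let height_leq n : (height n <= n)%N.
Proof. by elim: n => // n IH; case: (height_step n); lia. Qed.

Let m_passes t : (m 0 <= t)%N -> exists2 n, m n = t & m n.+1 = t.+1.
Proof.
(* Heights along the walk are unbounded and never exceed positions, so the walk gets beyond [t]. *)
move=> m0t; have tm : (t < m (rise t.+1))%N.
  by have := height_leq (m (rise t.+1)); rewrite height_m height_rise; lia.
elim: (rise t.+1) tm => [|n IH] tm; first by lia.
have [/IH //|mt] := ltnP t (m n); exists n; have := m_step n; lia.
Qed.

Lemma walk_meets_stop t : (m 0 <= t)%N -> fb t -> exists2 n, fa n & height n = height t.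
Proof.
move=> m0t fbt; have [n mn mn1] := m_passes m0t.
(* The time [(peak (m 0)).*2] is not before [m 0] and has height 0; passing it leaves no room for a
   positive height offset. *)
have [|n' mn' _] := m_passes (t := (peak (m 0)).*2).
  by have := leq_peak (m 0); lia.
have m00 : height (m 0) = 0%N.
  by have := height_m n'; rewrite mn' height_bottom; lia.
by exists n; [apply: m_stop; rewrite ?mn|rewrite -mn height_m m00 addn0].
Qed.

End WalkHeights.

(** * Folding *)

Section Fold.
Variables (R : realType) (X : set R) (fa fb : nat -> bool) (N : nat).
Implicit Types x y t : R.
Hypothesis X_mirror : forall t,
  0 <= t <= (peak N).*2%:R -> X ((peak N).*2%:R - t) <-> X t.
Hypothesis fb_low : forall n, (peak N <= n)%N -> (n < (peak N).*2)%N -> ~~ fb n.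
Hypothesis fb_high : forall n, ((peak N).*2 <= n)%N -> fb n -> fa n.

Local Notation H := (@clock R fa).
Local Notation K := (@clock R fb).
Local Notation top := ((peak N).*2%:R : R).

Let fold t : R := Num.max t (top - t).

(** Early times are reflected about [peak N] onto the descent free of pauses. Later, where the
    target clock pauses both clocks do, so the identity works; elsewhere the target clock is the
    identity and [H] itself is lifted. *)
Let lift_on n x : R :=
  if (n < (peak N).*2)%N then fold (H x) else if fb n then x else H x.

Let lift_glueable : glueable lift_on.
Proof.
move=> n; rewrite /lift_on natr1 !clock_nat !if_same.
have [nN|nN] := ltnP n (peak N).*2; last by rewrite ifF //; lia.
case: ifPn => // nN'; have -> : n.+1 = (peak N).*2 by lia.
by rewrite /fold subrr max_l.
Qed.

Let lift_continuous : continuous (glue lift_on).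
Proof.
apply: glue_continuous => // n; have cH : continuous H by exact: clock_continuous.
rewrite /lift_on; case: (n < _)%N; last by case: (fb n) => // x; exact: cvg_id.
apply: (continuous_compT cH); apply: continuous_maxT => x; first exact: cvg_id.
by apply: cvgB; [exact: cvg_cst|exact: cvg_id].
Qed.

Let clock_fold t : 0 <= t <= top -> K (fold t) = fold t.
Proof.
move=> /andP[t0 tN]; set s := fold t.
have [sT sN] : (peak N)%:R <= s /\ s <= top.
  by rewrite /s /fold -muln2 natrM le_max ge_max in tN *; split; lra.
move: sN; rewrite le_eqVlt => /orP[/eqP ->|sN]; first by rewrite clock_nat.
have s0 : 0 <= s by apply: le_trans sT; exact: ler0n.
have /andP[ns sn] := truncn_itv1 s0; apply: (@clock_id _ _ (Num.truncn s)); last first.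
  by rewrite ns ltW.
by apply: fb_low; [rewrite truncn_ge_nat|rewrite truncn_lt_nat].
Qed.

Let clock_lift x : K (glue lift_on x) = fold (H x).
Proof.
have high t : top <= t -> fold t = t.
  by move=> ht; rewrite /fold max_l //; have := ler0n R (peak N).*2; lra.
have [x0|x0] := ltP x 0.
  have Hx : H x = 0 by rewrite clock_le0 // ltW.
  have H0 : H 0 = 0 by exact: (@clock_nat R fa 0).
  rewrite glue0; last by lra.
  rewrite /lift_on; case: ifPn => [_|].
    by rewrite clock_fold // Hx lexx ler0n.
  (* Here [peak N = 0], and the lift may be the identity even at negative [x]; the target clock
     still gives 0. *)
  rewrite -leqNgt leqn0 => /eqP p0; rewrite Hx high ?p0 //.
  by case: (fb 0); [rewrite clock_le0 // ltW|exact: (@clock_nat R fb 0)].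
have /andP[nx xn] := truncn_itv1 x0; set n := Num.truncn x in nx xn.
have nxn : n%:R <= x <= n%:R + 1 by rewrite nx ltW.
have /andP[nH Hn] := clock_itv fa nxn.
rewrite (glueE _ nxn) // /lift_on; case: ifPn => [nN|].
  rewrite clock_fold // clock_ge0 (le_trans Hn) // natr1 ler_nat //.
rewrite -leqNgt => nN; rewrite high; last by rewrite (le_trans _ nH) // ler_nat.
case: ifPn => fbn; first by apply: (eq_clock fbn (fb_high nN fbn) nxn).
by apply: (clock_id fbn); rewrite nH.
Qed.

Let X_fold t : 0 <= t -> X (fold t) <-> X t.
Proof.
move=> t0; rewrite /fold; have [//|tt] := leP (top - t) t.
by apply: X_mirror; rewrite t0; lra.
Qed.

Lemma clock_reduction : exists2 g : R -> R, continuous g &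
  forall x, X (H x) <-> X (K (g x)).
Proof.
exists (glue lift_on) => // x; rewrite clock_lift; symmetry; apply: X_fold.
exact: clock_ge0.
Qed.

End Fold.

(** * Coding sets of indices by pauses *)

(** Pauses mark the complement of [a], because a reduction needs each pause of its target to be
    matched by one of its source. *)
Definition stops (a : set nat) (n : nat) : bool := `[< exists2 k, n = rise k & ~ a k >].

Lemma stops_rise a k : stops a (rise k) <-> ~ a k.
Proof.
split=> [/asboolP[l E]|ak]; last by apply/asboolP; exists k.
by rewrite -(height_rise k) E height_rise.
Qed.

Lemma finite_set_bounded (A : set nat) : finite_set A ->
  exists N, forall k, A k -> (k < N)%N.
Proof.
move=> /finite_seqP[s ->]; exists (\max_(i <- s) i).+1 => k /= ks.
by rewrite ltnS; apply: (@leq_bigmax_seq _ s xpredT id).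
Qed.

Theorem theorem1p2 (R : realType) :
  exists F : set nat -> set R,
    (forall a : set nat, monotone_reducible_to_rationals (F a)) /\
    (forall a b : set nat, subset_fin a b <-> wadge_le (F a) (F b)).
Proof.
have [X [Xplat Xcol Xhalf Xmir [h [ch hh Xh]]]] := coloured_timeline R.
exists (fun a => [set x | X (clock (stops a) x)]); split=> [a|a b].
  exists (h \o clock (stops a)); split.
  - by apply: continuous_compT => //; exact: clock_continuous.
  (* [h] is known to be monotone on nonnegative reals, where the clock takes its values. *)
  - by left=> x y xy; apply: hh; [exact: clock_ge0|exact: clock_homo].
  - by apply/seteqP; split=> x /=; rewrite -Xh ?clock_ge0.
split=> [/finite_set_bounded[N abN]|[g [cg E]]].
  have high k : (N <= k)%N -> a k -> b k.
    move=> Nk ak; apply: contrapT => bk.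
    by have := abN k (conj ak bk); rewrite ltnNge Nk.
  have peakN k n : n = rise k -> (peak N <= n)%N -> (N <= k)%N.
    by move=> -> ; rewrite leqNgt => /negP rk; rewrite leqNgt; apply/negP => /rise_lt_peak.
  have [||g cg gE] := @clock_reduction R X (stops a) (stops b) N (Xmir N).
  (* A step [rise k] at or after [peak N] has [k >= N], hence does not come before [(peak N).*2]: no
     pause falls on the descent. *)
  - move=> n Nn nN; apply/asboolP => -[k nk _].
    by move: nN; rewrite nk ltnNge leq_rise //; apply: (peakN k n).
  - move=> n Nn /asboolP[k nk bk]; apply/asboolP; exists k => // ak.
    by apply: bk; apply: high ak; apply: (peakN k n) => //; move: Nn; clear; lia.
  by exists g; split=> //; apply/seteqP; split=> x /= /gE.
have red x : X (clock (stops a) x) <-> X (clock (stops b) (g x)).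
  have := congr1 (fun A : set R => A x) E; rewrite /= => ->.
  by split.
have [m [m_odd m_step m_colour m_stop]] :=
  @reduction_walk R X (stops a) (stops b) g Xplat Xcol Xhalf cg red.
(* If [k >= m 0], then [rise k >= m 0] and the walk crosses this step upwards; a pause of [b] there
   yields a pause of [a] at some [rise l] of height [k], so [l = k] is outside [a]. *)
apply: (@sub_finite_set _ _ `I_(m 0)); last exact: finite_II.
move=> k [ak bk] /=; rewrite ltnNge; apply/negP => mk.
have m0 : (m 0 <= rise k)%N by rewrite (leq_trans mk) // /rise leq_addl.
have [n /asboolP[l ->]] := walk_meets_stop m_odd m_step m_colour m_stop m0
  ((stops_rise b k).2 bk).
by rewrite !height_rise => al kl; apply: al; rewrite kl.
Qed.
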